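(* ($G$-invariant definable Tietze extension theorem.) Let $\mathcal F=(F,<,+,\cdot,0,1,\ldots)$ be a definably complete expansion of an ordered field. Let $G\subseteq F^m$ be a definably compact definable topological group and let $X\subseteq F^n$ be a definable $G$-set which is locally closed in $F^n$. Let $A\subseteq X$ be a definable $G$-invariant subset which is closed in $X$, and let $\varphi:A\to F$ be a $G$-invariant definable continuous function. Then there exists a $G$-invariant definable continuous function $\Phi:X\to F$ with $\Phi|_A=\varphi$.
   Context: All topologies are the order topology on $F$ and the product topology on $F^k$. ''Definable'' means definable in $\mathcal F$ with parameters. $\mathcal F$ is definably complete if every definable subset of $F$ has a supremum and an infimum in $F\cup\{\pm\infty\}$. A definable topological group is a group $(G,\cdot)$ whose underlying set is a definable subset of some $F^m$ and whose multiplication and inverse maps are definable and continuous. A definable set is definably compact if it is closed and bounded in its ambient space $F^m$. A definable $G$-set is a definable set $X\subseteq F^n$ on which $G$ acts via a definable continuous map $G\times X\to X$, $(g,x)\mapsto gx$. A subset $A\subseteq X$ is $G$-invariant if $gA\subseteq A$ for all $g\in G$; a function $f$ on a $G$-invariant set is $G$-invariant if $f(gx)=f(x)$ for all $g\in G$ and $x$ in its domain. *)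

(* Defs.v *)
From HB Require Import structures.
From mathcomp Require Import all_boot all_order all_algebra.
From mathcomp Require Import boolp classical_sets.
Set Implicit Arguments. Unset Strict Implicit. Unset Printing Implicit Defensive.
Import Order.TTheory GRing.Theory Num.Theory.
Local Open Scope ring_scope.
Local Open Scope classical_set_scope.

(* A "structure" on the ordered field R in the sense of van den Dries: for   *)
(* each n a family of subsets of R^n (the definable sets) closed under       *)
(* boolean operations, cartesian products and coordinate projections,        *)
(* containing the diagonals, the graphs of + and *, the order relation and   *)
(* all points (parameters).  The definable sets (with parameters) of any     *)
(* expansion of (R,<,+,*,0,1) form such a structure, and conversely every    *)
(* such structure is the collection of definable sets of the expansion of R  *)
(* by all of its members.                                                    *)
Unset Implicit Arguments.
Record structure (R : realFieldType) := Structure {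
  dfn : forall n : nat, set 'rV[R]_n -> Prop;
  dfn_setT : forall n, dfn n setT;
  dfn_setC : forall n (A : set 'rV[R]_n), dfn n A -> dfn n (~` A);
  dfn_setU : forall n (A B : set 'rV[R]_n), dfn n A -> dfn n B -> dfn n (A `|` B);
  dfn_prod : forall n k (A : set 'rV[R]_n) (B : set 'rV[R]_k),
      dfn n A -> dfn k B ->
      dfn (n + k) [set z | exists a b, [/\ A a, B b & z = row_mx a b]];
  dfn_proj : forall n k (A : set 'rV[R]_(n + k)),
      dfn (n + k) A -> dfn n [set lsubmx z | z in A];
  dfn_diag : forall n (i j : 'I_n), dfn n [set x | x ord0 i = x ord0 j];
  dfn_point : forall a : R, dfn 1 [set x | x ord0 ord0 = a];
  dfn_lt : dfn 2 [set x | x ord0 (inord 0) < x ord0 (inord 1)];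
  dfn_add : dfn 3 [set x | x ord0 (inord 2) = x ord0 (inord 0) + x ord0 (inord 1)];
  dfn_mul : dfn 3 [set x | x ord0 (inord 2) = x ord0 (inord 0) * x ord0 (inord 1)]
}.

Set Implicit Arguments.
Arguments dfn {R} s n A.
Coercion dfn : structure >-> Funclass.

Section Defs.
Variable R : realFieldType.
Variable S : structure R.

Definition definably_complete : Prop :=
  forall A : set R, S 1 [set x | A (x ord0 ord0)] ->
    ((exists a, A a) -> (exists b, forall a, A a -> a <= b) ->
       exists s, (forall a, A a -> a <= s) /\
                 (forall b, (forall a, A a -> a <= b) -> s <= b)) /\
    ((exists a, A a) -> (exists b, forall a, A a -> b <= a) ->
       exists s, (forall a, A a -> s <= a) /\
                 (forall b, (forall a, A a -> b <= a) -> b <= s)).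

(* product of order topologies on R^n: basic neighbourhoods are boxes *)
Definition box n (x : 'rV[R]_n) (e : R) : set 'rV[R]_n :=
  [set y | forall i, `|y ord0 i - x ord0 i| < e].

Definition open_set n (U : set 'rV[R]_n) : Prop :=
  forall x, U x -> exists e, 0 < e /\ box x e `<=` U.

Definition closed_set n (C : set 'rV[R]_n) : Prop := open_set (~` C).

Definition bounded_set n (A : set 'rV[R]_n) : Prop :=
  exists M : R, forall x, A x -> forall i, `|x ord0 i| <= M.

Definition definably_compact n (A : set 'rV[R]_n) : Prop :=
  S n A /\ closed_set A /\ bounded_set A.

Definition locally_closed n (X : set 'rV[R]_n) : Prop :=
  exists U C, [/\ open_set U, closed_set C & X = U `&` C].

Definition closed_in n (X A : set 'rV[R]_n) : Prop :=
  exists C, closed_set C /\ A = X `&` C.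

Definition continuous_on n k (A : set 'rV[R]_n) (f : 'rV[R]_n -> 'rV[R]_k) :=
  forall x, A x -> forall e, 0 < e -> exists d, 0 < d /\
    forall y, A y -> box x d y -> box (f x) e (f y).

Definition definable_fun n k (A : set 'rV[R]_n) (f : 'rV[R]_n -> 'rV[R]_k) :=
  S (n + k) [set z | exists x, A x /\ z = row_mx x (f x)].

Definition scal n (f : 'rV[R]_n -> R) : 'rV[R]_n -> 'rV[R]_1 :=
  fun x => const_mx (f x).

Definition pairs m k (G : set 'rV[R]_m) (X : set 'rV[R]_k) : set 'rV[R]_(m + k) :=
  [set z | G (lsubmx z) /\ X (rsubmx z)].

Definition definable_top_group m (G : set 'rV[R]_m)
  (mul : 'rV[R]_m -> 'rV[R]_m -> 'rV[R]_m) (inv : 'rV[R]_m -> 'rV[R]_m)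
  (e : 'rV[R]_m) : Prop :=
  [/\ S m G /\ G e,
      (forall g h, G g -> G h -> G (mul g h)) /\ (forall g, G g -> G (inv g)),
      (forall g h k, G g -> G h -> G k -> mul g (mul h k) = mul (mul g h) k) /\
      (forall g, G g -> mul e g = g /\ mul g e = g) /\
      (forall g, G g -> mul (inv g) g = e /\ mul g (inv g) = e),
      definable_fun (pairs G G) (fun z => mul (lsubmx z) (rsubmx z)) /\
      continuous_on (pairs G G) (fun z => mul (lsubmx z) (rsubmx z))
    & definable_fun G inv /\ continuous_on G inv].

Definition definable_G_set m n (G : set 'rV[R]_m)
  (mul : 'rV[R]_m -> 'rV[R]_m -> 'rV[R]_m) (e : 'rV[R]_m)
  (X : set 'rV[R]_n) (act : 'rV[R]_m -> 'rV[R]_n -> 'rV[R]_n) : Prop :=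
  [/\ S n X /\ (forall g x, G g -> X x -> X (act g x)),
      (forall x, X x -> act e x = x),
      (forall g h x, G g -> G h -> X x -> act (mul g h) x = act g (act h x)),
      definable_fun (pairs G X) (fun z => act (lsubmx z) (rsubmx z))
    & continuous_on (pairs G X) (fun z => act (lsubmx z) (rsubmx z))].

Definition G_invariant_set m n (G : set 'rV[R]_m)
  (act : 'rV[R]_m -> 'rV[R]_n -> 'rV[R]_n) (A : set 'rV[R]_n) : Prop :=
  forall g x, G g -> A x -> A (act g x).

Definition G_invariant_fun m n (G : set 'rV[R]_m)
  (act : 'rV[R]_m -> 'rV[R]_n -> 'rV[R]_n) (A : set 'rV[R]_n)
  (f : 'rV[R]_n -> R) : Prop :=
  forall g x, G g -> A x -> f (act g x) = f x.

End Defs.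

(* Main.v *)
Require Import Defs.
From HB Require Import structures.
From mathcomp Require Import all_boot all_order all_algebra.
From mathcomp Require Import boolp classical_sets.
From mathcomp Require Import lra.
Import Order.TTheory GRing.Theory Num.Theory.
Local Open Scope ring_scope.
Local Open Scope classical_set_scope.
Set Implicit Arguments. Unset Strict Implicit. Unset Printing Implicit Defensive.

(* The action is equicontinuous: if points [y] of [X] arbitrarily close to [x]
   had [gy] far from [gx], the offending [g] would cluster at some [s] in the
   closed bounded group [G], contradicting continuity of the action at [(s, x)].
   Hence the truncated distance [d(x, y) = sup_g min(1, |gx - gy|)] is a definable
   [G]-invariant metric inducing the topology of [X].  For [phi >= 0], Hausdorff's
   formula
     [Phi x = inf_(a in A) (phi a + d(x, a) / d(x, A) - 1)]  for [x] outside [A]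
   is a continuous extension, invariant because [d], [A] and [phi] are; in general
   extend [|phi|] and [|phi| - phi] and subtract. *)

(** * Definable predicates and functions *)

(* Types whose points are tuples of coordinates, so that predicates and functions
   on iterated products can be called definable without mentioning 'rV. *)
Record dtype (R : realFieldType) := DType {
  dsort :> Type;
  ddim : nat;
  dpoint : 'rV[R]_ddim -> dsort;
  dcoord : dsort -> 'rV[R]_ddim;
  dpointK : cancel dpoint dcoord;
  dcoordK : cancel dcoord dpoint
}.
Arguments DType {R dsort ddim dpoint dcoord}.
Arguments dpoint {R} d.

Lemma const_mx1K (R : realFieldType) :
  cancel (fun z : 'rV[R]_1 => z 0 0) (fun a => const_mx a).
Proof. by move=> z; apply/rowP => i; rewrite mxE !ord1. Qed.

Lemma mx1_constK (R : realFieldType) :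
  cancel (fun a => const_mx a) (fun z : 'rV[R]_1 => z 0 0).
Proof. by move=> a; rewrite mxE. Qed.

Lemma dprodK (R : realFieldType) (T U : dtype R) :
  cancel (fun z : 'rV[R]_(ddim T + ddim U) =>
            (dpoint T (lsubmx z), dpoint U (rsubmx z)))
         (fun p => row_mx (dcoord p.1) (dcoord p.2)).
Proof. by move=> z /=; rewrite !dpointK hsubmxK. Qed.

Lemma prod_dK (R : realFieldType) (T U : dtype R) :
  cancel (fun p : T * U => row_mx (dcoord p.1) (dcoord p.2))
         (fun z : 'rV[R]_(ddim T + ddim U) =>
            (dpoint T (lsubmx z), dpoint U (rsubmx z))).
Proof. by case=> x y /=; rewrite row_mxKl row_mxKr !dcoordK. Qed.

Canonical real_dtype (R : realFieldType) :=
  DType (@const_mx1K R) (@mx1_constK R).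
Canonical row_dtype (R : realFieldType) n :=
  @DType R 'rV[R]_n n id id (fun=> erefl) (fun=> erefl).
Canonical prod_dtype (R : realFieldType) (T U : dtype R) :=
  DType (@dprodK R T U) (@prod_dK R T U).

Section Definability.
Variables (R : realFieldType) (S : structure R).

Definition Def (T : dtype R) (P : T -> Prop) := S (ddim T) [set z | P (dpoint T z)].

(** The graph lies over all of [T], so definable functions are total here. *)
Definition defun (T U : dtype R) (f : T -> U) :=
  Def (fun p : T * U => p.2 = f p.1).

(* [f] merely selects, repeats and permutes coordinates. *)
Definition cmap (T U : dtype R) (f : T -> U) :=
  exists s : 'I_(ddim U) -> 'I_(ddim T), forall z,
    dcoord (f (dpoint T z)) = \row_j z 0 (s j).

Implicit Types T U V W : dtype R.

Lemma eq_dfn n (A B : set 'rV[R]_n) : (forall z, A z <-> B z) -> S n A -> S n B.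
Proof. by move=> AB; suff -> : A = B by []; apply/seteqP; split=> z /AB. Qed.

Lemma eq_Def T (P Q : T -> Prop) : (forall t, P t <-> Q t) -> Def P -> Def Q.
Proof. by move=> PQ; apply: eq_dfn => z; apply: PQ. Qed.

Lemma DefT T : Def (fun _ : T => True). Proof. exact: dfn_setT. Qed.

Lemma DefN T (P : T -> Prop) : Def P -> Def (fun t => ~ P t).
Proof. exact: dfn_setC. Qed.

Lemma DefU T (P Q : T -> Prop) : Def P -> Def Q -> Def (fun t => P t \/ Q t).
Proof. exact: dfn_setU. Qed.

Lemma DefI T (P Q : T -> Prop) : Def P -> Def Q -> Def (fun t => P t /\ Q t).
Proof.
move=> dP dQ; apply: eq_Def (DefN (DefU (DefN dP) (DefN dQ))) => t.
by rewrite not_orE !notK.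
Qed.

Lemma Defimp T (P Q : T -> Prop) : Def P -> Def Q -> Def (fun t => P t -> Q t).
Proof.
move=> dP dQ; apply: eq_Def (DefU (DefN dP) dQ) => t.
by rewrite -implyE.
Qed.

Lemma Defex T U (P : T -> U -> Prop) :
  Def (fun p : T * U => P p.1 p.2) -> Def (fun t => exists u, P t u).
Proof.
move=> /dfn_proj; apply: eq_dfn => z; split => /=.
  by case=> w Pw <-; exists (dpoint U (rsubmx w)).
case=> u Pu; exists (row_mx z (dcoord u)); last by rewrite row_mxKl.
by rewrite /= row_mxKl row_mxKr dcoordK.
Qed.

Lemma Defall T U (P : T -> U -> Prop) :
  Def (fun p : T * U => P p.1 p.2) -> Def (fun t => forall u, P t u).
Proof.
move=> dP; apply: eq_Def (DefN (Defex (P := fun t u => ~ P t u) (DefN dP))) => t.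
by rewrite -forallNE; split=> H u; [apply: contrapT; apply: H|case/(_ (H u))].
Qed.

Lemma Defall_ord T k (P : 'I_k -> T -> Prop) :
  (forall i, Def (P i)) -> Def (fun t => forall i, P i t).
Proof.
move=> dP.
suff: Def (fun t => forall i, i \in enum 'I_k -> P i t).
  by apply: eq_Def => t; split=> H i *; apply: H; rewrite ?mem_enum.
elim: (enum 'I_k) => [|j s IH]; first by apply: eq_Def (DefT T).
apply: eq_Def (DefI (dP j) IH) => t; split=> [[Pj Ps] i|H].
  by rewrite inE => /predU1P[->|/Ps].
by split=> [|i si]; apply: H; rewrite inE ?eqxx ?si ?orbT.
Qed.

(** Substitution of variables. Diagonals identify the [j]-th coordinate of the second block with
    coordinate [s j] of the first; intersecting with the cylinder over [P] and projecting to the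
    first block gives the preimage of [P]. *)
Lemma Def_cmap T U (f : T -> U) (P : U -> Prop) :
  cmap f -> Def P -> Def (fun t => P (f t)).
Proof.
case=> s fs dP.
have d1 : Def (fun z : 'rV[R]_(ddim T + ddim U) =>
    forall j, z 0 (rshift _ j) = z 0 (lshift _ (s j))).
  by apply: Defall_ord => j; apply: dfn_diag.
have d2 : Def (fun z : 'rV[R]_(ddim T + ddim U) =>
    exists a b, [/\ True, P (dpoint U b) & z = row_mx a b]).
  exact: dfn_prod (dfn_setT _ S (ddim T)) dP.
have /dfn_proj := DefI d1 d2.
apply: eq_dfn => z; split => /=.
  case=> w [/= ws [a [b [_ Pb ew]]]] <-.
  rewrite -[f _]dcoordK fs; move: Pb; congr P; congr dpoint; apply/rowP => j.
  by move: (ws j); rewrite ew row_mxKl row_mxEr row_mxEl !mxE => ->.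
move=> Pz; exists (row_mx z (dcoord (f (dpoint T z)))); last by rewrite row_mxKl.
split=> [j|]; first by rewrite row_mxEr row_mxEl fs mxE.
by exists z, (dcoord (f (dpoint T z))); split=> //=; rewrite dcoordK.
Qed.

Lemma cmap_id T : cmap (fun t : T => t).
Proof. by exists id => z; rewrite dpointK; apply/rowP => j; rewrite mxE. Qed.

Lemma cmap_fst T U V (f : T -> U * V) : cmap f -> cmap (fun t => (f t).1).
Proof.
case=> s fs; exists (fun j => s (lshift _ j)) => z; apply/rowP => j.
by move/rowP/(_ (lshift _ j)): (fs z); rewrite /= row_mxEl !mxE.
Qed.

Lemma cmap_snd T U V (f : T -> U * V) : cmap f -> cmap (fun t => (f t).2).
Proof.
case=> s fs; exists (fun j => s (rshift _ j)) => z; apply/rowP => j.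
by move/rowP/(_ (rshift _ j)): (fs z); rewrite /= row_mxEr !mxE.
Qed.

Lemma cmap_pair T U V (f : T -> U) (g : T -> V) :
  cmap f -> cmap g -> cmap (fun t => (f t, g t)).
Proof.
move=> [s fs] [r gr].
exists (fun j => match split j with inl i => s i | inr i => r i end) => z.
by apply/rowP => j; rewrite mxE /= [LHS]mxE; case: split => i; rewrite ?fs ?gr mxE.
Qed.

Lemma cmap_coord T k (f : T -> 'rV[R]_k) j : cmap f -> cmap (fun t => f t 0 j).
Proof.
case=> s fs; exists (fun _ => s j) => z; apply/rowP => i.
by move/rowP/(_ j): (fs z); rewrite /= !mxE.
Qed.

Lemma Def_row_eq T k (f g : T -> 'rV[R]_k) :
  cmap f -> cmap g -> Def (fun t => f t = g t).
Proof.
move=> [s fs] [r gr].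
have d : Def (fun t : T => forall j, dcoord t 0 (s j) = dcoord t 0 (r j)).
  apply: Defall_ord => j; rewrite /Def.
  by under eq_set do rewrite dpointK; apply: dfn_diag.
apply: eq_Def d => t; move: (fs (dcoord t)) (gr (dcoord t)).
rewrite dcoordK /= => -> ->; split=> [H|/rowP H j]; last by have := H j; rewrite !mxE.
by apply/rowP => j; rewrite !mxE.
Qed.

Lemma Def_eq_cmap T U (f g : T -> U) :
  cmap f -> cmap g -> Def (fun t => f t = g t).
Proof.
move=> cf cg; apply: eq_Def (@Def_row_eq T _ (fun t => dcoord (f t))
  (fun t => dcoord (g t)) cf cg) => t.
by split=> [/(can_inj (@dcoordK _ _))|->].
Qed.

Lemma defun_cmap T U (f : T -> U) : cmap f -> defun f.
Proof.
move=> cf; apply: Def_eq_cmap; first exact/cmap_snd/cmap_id.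
case: cf => s fs; exists (fun j => lshift _ (s j)) => z /=; rewrite fs.
by apply/rowP => j; rewrite !mxE.
Qed.

Lemma Def_comp T U (f : T -> U) (P : U -> Prop) :
  defun f -> Def P -> Def (fun t => P (f t)).
Proof.
move=> df dP.
apply: (@eq_Def _ (fun t => exists u, u = f t /\ P u)) => [t|].
  by split=> [[u [->]]|Pf] //; exists (f t).
by apply: Defex; apply: DefI => //; apply: Def_cmap dP; apply/cmap_snd/cmap_id.
Qed.

Lemma defun_comp T U V (g : U -> V) (f : T -> U) :
  defun g -> defun f -> defun (fun t => g (f t)).
Proof.
move=> dg df.
apply: (@eq_Def _ (fun p : T * V => exists u, u = f p.1 /\ p.2 = g u)) => [p|].
  by split=> [[u [->]]|->] //; exists (f p.1).
apply: Defex; apply: DefI => /=.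
  apply: (@Def_cmap (T * V * U)%type (T * U)%type (fun p => (p.1.1, p.2)) _ _ df).
  by apply: cmap_pair; [apply/cmap_fst/cmap_fst/cmap_id|apply/cmap_snd/cmap_id].
apply: (@Def_cmap (T * V * U)%type (U * V)%type (fun p => (p.2, p.1.2)) _ _ dg).
by apply: cmap_pair; [apply/cmap_snd/cmap_id|apply/cmap_snd/cmap_fst/cmap_id].
Qed.

Lemma defun_pair T U V (f : T -> U) (g : T -> V) :
  defun f -> defun g -> defun (fun t => (f t, g t)).
Proof.
move=> df dg.
apply: (@eq_Def (T * (U * V))%type (fun p => p.2.1 = f p.1 /\ p.2.2 = g p.1)).
  by move=> [t [u v]] /=; split=> [[-> ->]|[-> ->]].
apply: DefI.
  apply: (@Def_cmap (T * (U * V))%type (T * U)%type (fun p => (p.1, p.2.1)) _ _ df).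
  by apply: cmap_pair; [apply/cmap_fst/cmap_id|apply/cmap_fst/cmap_snd/cmap_id].
apply: (@Def_cmap (T * (U * V))%type (T * V)%type (fun p => (p.1, p.2.2)) _ _ dg).
by apply: cmap_pair; [apply/cmap_fst/cmap_id|apply/cmap_snd/cmap_snd/cmap_id].
Qed.

Lemma defun_id T : defun (fun t : T => t).
Proof. exact/defun_cmap/cmap_id. Qed.

Lemma defun_fst T U V (f : T -> U * V) : defun f -> defun (fun t => (f t).1).
Proof. by apply: defun_comp; apply/defun_cmap/cmap_fst/cmap_id. Qed.

Lemma defun_snd T U V (f : T -> U * V) : defun f -> defun (fun t => (f t).2).
Proof. by apply: defun_comp; apply/defun_cmap/cmap_snd/cmap_id. Qed.

Lemma defun_coord T k (f : T -> 'rV[R]_k) j :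
  defun f -> defun (fun t => f t 0 j).
Proof.
apply: (defun_comp (g := fun x : 'rV[R]_k => x 0 j)).
exact/defun_cmap/cmap_coord/cmap_id.
Qed.

Lemma Def_comp2 T U V (f : T -> U) (g : T -> V) (P : U -> V -> Prop) :
  Def (fun p : U * V => P p.1 p.2) -> defun f -> defun g ->
  Def (fun t => P (f t) (g t)).
Proof. by move=> dP df dg; apply: (Def_comp (defun_pair df dg) dP). Qed.

Lemma defun_comp2 T U V W (f : T -> U) (g : T -> V) (h : U -> V -> W) :
  defun (fun p : U * V => h p.1 p.2) -> defun f -> defun g ->
  defun (fun t => h (f t) (g t)).
Proof. by move=> dh df dg; apply: (defun_comp dh (defun_pair df dg)). Qed.

Lemma Def_eq T U (f g : T -> U) : defun f -> defun g -> Def (fun t => f t = g t).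
Proof.
move=> df dg; apply: (@Def_comp T (prod_dtype U U) (fun t => (f t, g t)) (fun p => p.1 = p.2)).
  exact: defun_pair df dg.
by apply: Def_eq_cmap; [apply/cmap_fst/cmap_id|apply/cmap_snd/cmap_id].
Qed.

Lemma Def_eqR T (f g : T -> R) : defun f -> defun g -> Def (fun t => f t = g t).
Proof. exact: Def_eq. Qed.

Lemma Def_lt T (f g : T -> R) : defun f -> defun g -> Def (fun t => f t < g t).
Proof.
move=> df dg; apply: (@Def_comp T (prod_dtype (real_dtype R) (real_dtype R)) (fun t => (f t, g t))
  (fun p => p.1 < p.2)).
  exact: defun_pair df dg.
apply: eq_dfn (dfn_lt _ S) => z /=; rewrite !mxE.
have -> : inord 0 = lshift 1 0 :> 'I_(1 + 1) by apply/val_inj; rewrite /= inordK.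
by have -> : inord 1 = rshift 1 0 :> 'I_(1 + 1) by apply/val_inj; rewrite /= inordK.
Qed.

Lemma Def_le T (f g : T -> R) : defun f -> defun g -> Def (fun t => f t <= g t).
Proof.
move=> df dg; apply: eq_Def (DefN (Def_lt dg df)) => t.
by rewrite leNgt; split=> /negP.
Qed.

(** Points are given as definable in dimension 1 only, so equality with [c] is tested coordinate by
    coordinate. *)
Lemma defun_const T U (c : U) : defun (fun _ : T => c).
Proof.
apply: (@eq_Def (prod_dtype T U) (fun p => forall j, dcoord p.2 0 j = dcoord c 0 j)).
  move=> [t u] /=; split=> [H|-> //].
  by apply: (can_inj (@dcoordK _ _)); apply/rowP.
apply: Defall_ord => j.
apply: (@Def_cmap (prod_dtype T U) (real_dtype R) (fun p => dcoord p.2 0 j)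
  (fun r => r = dcoord c 0 j)); last exact: dfn_point.
exists (fun=> rshift _ j) => z; apply/rowP => i; rewrite /= dpointK !mxE.
by congr (z _ _).
Qed.

Lemma defun_binop T (op : R -> R -> R) (f g : T -> R) :
  Def (fun p : R * R * R => p.2 = op p.1.1 p.1.2) ->
  defun f -> defun g -> defun (fun t => op (f t) (g t)).
Proof.
move=> dop df dg; apply: (defun_comp (g := fun p => op p.1 p.2)) (defun_pair df dg).
exact: dop.
Qed.

(** Matches the numbering of coordinates in the axioms for [+] and [*] with the blocks of a nested
    product. *)
Lemma Def_triple (P : R -> R -> R -> Prop) :
  S 3 [set x | P (x 0 (inord 0)) (x 0 (inord 1)) (x 0 (inord 2))] ->
  Def (fun p : R * R * R => P p.1.1 p.1.2 p.2).
Proof.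
have -> : inord 0 = lshift 1 (lshift 1 0) :> 'I_(1 + 1 + 1)
  by apply/val_inj; rewrite /= inordK.
have -> : inord 1 = lshift 1 (rshift 1 0) :> 'I_(1 + 1 + 1)
  by apply/val_inj; rewrite /= inordK.
have -> : inord 2 = rshift 2 0 :> 'I_(1 + 1 + 1)
  by apply/val_inj; rewrite /= inordK.
by apply: eq_dfn => z /=; rewrite !mxE.
Qed.

Lemma defun_add T (f g : T -> R) :
  defun f -> defun g -> defun (fun t => f t + g t).
Proof.
by apply: defun_binop; apply: (Def_triple (P := fun a b c => c = a + b)); apply: dfn_add.
Qed.

Lemma defun_mul T (f g : T -> R) :
  defun f -> defun g -> defun (fun t => f t * g t).
Proof.
by apply: defun_binop; apply: (Def_triple (P := fun a b c => c = a * b)); apply: dfn_mul.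
Qed.

Lemma defun_opp T (f : T -> R) : defun f -> defun (fun t => - f t).
Proof.
move=> df; apply: (eq_Def (P := fun p : T * R => p.2 + f p.1 = 0)).
  by move=> [t r] /=; split=> [/eqP|->]; rewrite ?addNr ?addr_eq0 => // /eqP.
apply: Def_eqR; last exact: (defun_const _ (0 : R)).
apply: defun_add; first exact/defun_snd/defun_id.
exact/(defun_comp df)/defun_fst/defun_id.
Qed.

Lemma defun_if T U (P : T -> Prop) (f g : T -> U) : Def P -> defun f -> defun g ->
  defun (fun t => if `[< P t >] then f t else g t).
Proof.
move=> dP df dg.
have dP1 : Def (fun p : T * U => P p.1).
  by apply: Def_comp dP; apply/defun_fst/defun_id.
apply: eq_Def (DefU (DefI dP1 df) (DefI (DefN dP1) dg)) => -[t u] /=.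
by case: asboolP => Pt; tauto.
Qed.

(** The graph of inversion is the hyperbola [x * y = 1] together with the origin, the latter because
    [0^-1 = 0]. *)
Lemma defun_inv T (f : T -> R) : defun f -> defun (fun t => (f t)^-1).
Proof.
apply: (defun_comp (g := fun x : R => x^-1)).
have d1 : defun (fun p : R * R => p.1) by apply/defun_fst/defun_id.
have d2 : defun (fun p : R * R => p.2) by apply/defun_snd/defun_id.
have c T' (r : R) : defun (fun _ : T' => r) by apply: defun_const.
have d := DefU (DefI (Def_eqR d1 (c _ 0)) (Def_eqR d2 (c _ 0)))
  (Def_eqR (defun_mul d1 d2) (c _ 1)).
apply: eq_Def d => -[x y] /=; split=> [[[-> ->]|xy]|->]; first by rewrite invr0.
  have x0 : x != 0 by apply: contra_eq_neq xy => ->; rewrite mul0r eq_sym oner_eq0.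
  by apply: (mulfI x0); rewrite mulfV.
by case: (eqVneq x 0) => [->|x0]; [left; rewrite invr0|right; rewrite mulfV].
Qed.

Lemma defun_norm T (f : T -> R) : defun f -> defun (fun t => `|f t|).
Proof.
move=> df; have d := defun_if (Def_le (defun_const T (0 : R)) df) df (defun_opp df).
apply: eq_Def d => -[t r] /=; case: asboolP => [/ger0_norm ->//|/negP].
by rewrite -ltNge => /ltr0_norm ->.
Qed.

(* Partial definable functions are extended by a constant, so that definable
   functions compose without side conditions. *)
Lemma defun_total T U (P : T -> Prop) (f : T -> U) :
  Def (fun p : T * U => P p.1 /\ p.2 = f p.1) ->
  Def P /\ forall c, defun (fun t => if `[< P t >] then f t else c).
Proof.
move=> df; have dP : Def P.
  apply: eq_Def (Defex (P := fun t u => P t /\ u = f t) df) => t.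
  by split=> [[u []] | Pt] //; exists (f t).
split=> // c.
have dP1 : Def (fun p : T * U => P p.1).
  by apply: Def_comp dP; apply/defun_fst/defun_id.
have dc : Def (fun p : T * U => p.2 = c).
  by apply: Def_eq (defun_const _ _); apply/defun_snd/defun_id.
apply: eq_Def (DefU df (DefI (DefN dP1) dc)) => -[t u] /=.
by case: asboolP => Pt; tauto.
Qed.

End Definability.

(** Recursion on the syntax of the predicate or function. Definability of named symbols is looked up
    in the context, for binary ones in the form [fun p => h p.1 p.2], so the facts needed are put
    there beforehand. *)
Ltac def := cbn beta; lazymatch goal with
  | H : Def _ ?P |- Def _ ?P => exact: H
  | H : defun _ ?f |- defun _ ?f => exact: H
  | |- defun _ fst => exact: (defun_fst (defun_id _ _))
  | |- defun _ snd => exact: (defun_snd (defun_id _ _))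
  | |- Def _ (fun _ => True) => apply: DefT
  | |- Def _ (fun t => _ /\ _) => apply: DefI; def
  | |- Def _ (fun t => _ \/ _) => apply: DefU; def
  | |- Def _ (fun t => ~ _) => apply: DefN; def
  | |- Def _ (fun t => exists u, _) => apply: Defex; def
  | |- Def _ (fun t => is_true (_ < _)) => apply: Def_lt; def
  | |- Def _ (fun t => is_true (_ <= _)) => apply: Def_le; def
  | |- Def _ (fun t => _ = _) => first [apply: Def_eqR | apply: Def_eq]; def
  | |- Def _ (fun t => forall i : 'I__, _) => apply: Defall_ord => ?; def
  | |- Def _ (fun t => (@?P t) -> (@?Q t)) => apply: (Defimp (P := P) (Q := Q)); def
  | |- Def _ (fun t => forall u, _) => apply: Defall; def
  | H : Def _ ?P |- Def _ (fun t => ?P (@?f t)) => apply: (Def_comp (f := f) _ H); def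
  | H : Def _ (fun p => ?P p.1 p.2) |- Def _ (fun t => ?P (@?f t) (@?g t)) =>
      apply: (Def_comp2 (f := f) (g := g) H); def
  | |- defun _ (fun _ => ?c) => apply: defun_const
  | |- defun _ (fun t => t) => apply: defun_id
  | |- defun _ (fun t => (_, _)) => apply: defun_pair; def
  | |- defun _ (fun t => fst _) => apply: defun_fst; def
  | |- defun _ (fun t => snd _) => apply: defun_snd; def
  | |- defun _ (fun t => fun_of_matrix _ _ _) => apply: defun_coord; def
  | |- defun _ (fun t => _ + _) => apply: defun_add; def
  | |- defun _ (fun t => - _) => apply: defun_opp; def
  | |- defun _ (fun t => _ * _) => apply: defun_mul; def
  | |- defun _ (fun t => _^-1) => apply: defun_inv; def
  | |- defun _ (fun t => `|_|) => apply: defun_norm; def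
  | |- defun _ (fun t => if `[< _ >] then _ else _) => apply: defun_if; def
  | H : defun _ ?h |- defun _ (fun t => ?h (@?f t)) =>
      apply: (defun_comp (f := f) H); def
  | H : defun _ (fun p => ?h p.1 p.2) |- defun _ (fun t => ?h (@?f t) (@?g t)) =>
      apply: (defun_comp2 (f := f) (g := g) H); def
  end.

(** * Infima of definable families *)

Section Infimum.
Variables (R : realFieldType) (S : structure R).

Definition is_inf (P : R -> Prop) (s : R) :=
  (forall r, P r -> s <= r) /\ (forall b, (forall r, P r -> b <= r) -> b <= s).

(* Junk value 0 when the infimum does not exist. *)
Definition infR (P : R -> Prop) : R := xget 0 (is_inf P).

Lemma is_inf_unique P s s' : is_inf P s -> is_inf P s' -> s = s'.
Proof. by move=> [l g] [l' g']; apply/le_anti; rewrite g' ?g. Qed.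

(** Being an infimum is a first-order condition, and so is having none, which accounts for the junk
    value. *)
Lemma defun_inf (T : dtype R) (P : T -> R -> Prop) :
  Def S (fun p : T * R => P p.1 p.2) -> defun S (fun t => infR (P t)).
Proof.
move=> dP.
apply: (@eq_Def _ _ _ (fun p : T * R => is_inf (P p.1) p.2 \/
    ~ (exists s, is_inf (P p.1) s) /\ p.2 = 0)).
  move=> [t r] /=; rewrite /infR; case: xgetP => [s -> sP|nP]; split.
  - case=> [rP|[nE]]; first exact: is_inf_unique rP sP.
    by case: nE; exists (xget 0 (is_inf (P t))).
  - by move=> ->; left.
  - by case=> [/nP|[]].
  - by move=> ->; right; split=> // -[s /nP].
by rewrite /is_inf; def.
Qed.

Lemma infRP (P : R -> Prop) : definably_complete S -> Def S P ->
  (exists r, P r) -> (exists b, forall r, P r -> b <= r) -> is_inf P (infR P).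
Proof.
move=> DC dP nP bP; case: (DC P dP) => _ /(_ nP bP) [s sP].
exact: xgetPex (ex_intro _ s sP).
Qed.

Lemma infR_ge (P : R -> Prop) (b : R) : definably_complete S -> Def S P ->
  (exists r, P r) -> (forall r, P r -> b <= r) -> b <= infR P.
Proof. by move=> DC dP nP bP; apply: (infRP DC dP nP _).2 => //; exists b. Qed.

Lemma infR_le (P : R -> Prop) (b r : R) : definably_complete S -> Def S P ->
  (forall r, P r -> b <= r) -> P r -> infR P <= r.
Proof. by move=> DC dP bP Pr; apply: (infRP DC dP _ _).1 => //; [exists r|exists b]. Qed.

End Infimum.

(** * Cluster points of decreasing definable families *)

Section ClusterPoint.
Variables (R : realFieldType) (S : structure R) (m : nat).
Hypothesis DC : definably_complete S.
Implicit Type D : R -> 'rV[R]_m -> Prop.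

(** The definable substitute for a sequence in a compactness argument: the index is a tolerance and
    the members shrink as it tends to 0. *)
Definition decreasing_family D :=
  [/\ Def S (fun p : R * 'rV[R]_m => D p.1 p.2),
      forall d d' g, d' <= d -> D d' g -> D d g
    & forall d, 0 < d -> exists g, D d g].

(* [s] is the limit inferior of the [i]-th coordinate: the supremum of its lower
   bounds on the members of the family. *)
Lemma refine_family D (M : R) (i : 'I_m) :
  decreasing_family D -> (forall d g, D d g -> `|g 0 i| <= M) ->
  exists s, decreasing_family (fun d g => D d g /\ `|g 0 i - s| < d).
Proof.
move=> [dD decD neD] bD.
pose P r := exists d, 0 < d /\ forall g, D d g -> r <= g 0 i.
have dP : Def S P by rewrite /P; def.
have P_le r : P r -> r <= M.
  case=> d [d0 rD]; have [g Dg] := neD _ d0.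
  by apply: le_trans (rD _ Dg) _; apply: le_trans (bD _ _ Dg); apply: ler_norm.
have PM : P (- M).
  by exists 1; split=> // g /bD; rewrite ler_norml => /andP[].
have [s [s_ge s_le]] := (DC dP).1 (ex_intro _ _ PM) (ex_intro _ _ P_le).
exists s; split.
- def.
- by move=> d d' g dd' [Dg gs]; split; [apply: decD Dg|apply: lt_le_trans dd'].
move=> d d0.
have [r [d1 [d10 rD]] sr] : exists2 r, P r & s - d < r.
  apply: contrapT => H; have : s <= s - d; last lra.
  apply: s_le => r Pr; rewrite leNgt; apply/negP => sr.
  by apply: H; exists r.
pose d2 := Num.min d d1.
have d20 : 0 < d2 by rewrite lt_min d0.
(* Otherwise [s + d] would bound the coordinate from below on [D d2], hence lie in [P] and be at
   most [s]. *)
have [g Dg gs] : exists2 g, D d2 g & g 0 i < s + d.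
  apply: contrapT => H; have : s + d <= s; last lra.
  apply: s_ge; exists d2; split=> // g Dg.
  by rewrite leNgt; apply/negP => gs; apply: H; exists g.
exists g; split; first by apply: decD Dg; rewrite ge_min lexx.
have := rD g (decD _ _ _ _ Dg); rewrite ge_min lexx orbT => /(_ isT).
by rewrite ltr_norml => rg; apply/andP; split; lra.
Qed.

(** Bolzano-Weierstrass for definable families: the coordinates are made to converge one after the
    other, each refinement being again a decreasing family. *)
Lemma cluster_point D (M : R) :
  decreasing_family D -> (forall d g, D d g -> forall i, `|g 0 i| <= M) ->
  exists s, forall d, 0 < d -> exists2 g, D d g & box s d g.
Proof.
move=> dD bD.
suff [s [_ _ nes]] : exists s : 'rV[R]_m, decreasing_family
    (fun d g => D d g /\ forall i, i \in enum 'I_m -> `|g 0 i - s 0 i| < d).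
  by exists s => d /nes [g [Dg gs]]; exists g => // i; apply: gs; rewrite mem_enum.
elim: (enum 'I_m) (enum_uniq 'I_m) => [_|i e IH /= /andP[ie /IH [s fs]]].
  exists 0; have <- // : D = (fun d g => D d g /\
    forall i, i \in [::] -> `|g 0 i - (0 : 'rV_m) 0 i| < d).
  by apply/funext => d; apply/funext => g; apply/propext; split=> [|[]].
have [d g [/bD]//|r fr] := refine_family (M := M) (i := i) fs.
(* Only coordinate [i] of [s] is overwritten; as [i] is not in [e], the coordinates already treated
   keep their limits. *)
exists (\row_j if j == i then r else s 0 j).
have <- // : (fun d g => (D d g /\ forall i, i \in e -> `|g 0 i - s 0 i| < d) /\
     `|g 0 i - r| < d) = (fun d g => D d g /\ forall j, j \in i :: e ->
     `|g 0 j - (\row_j if j == i then r else s 0 j) 0 j| < d).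
apply/funext => d; apply/funext => g; apply/propext; split.
  move=> [[Dg gs] gr]; split=> // j; rewrite inE mxE; case: eqP => [-> //|_ /=].
  exact: gs.
move=> [Dg gs]; split; last first.
  by have := gs i; rewrite inE eqxx mxE eqxx; apply.
split=> // j je; have := gs j; rewrite inE je orbT mxE => /(_ isT).
by case: eqP je ie => // -> ->.
Qed.

End ClusterPoint.

(** * Hausdorff's extension formula *)

Section HausdorffExtension.
Variables (R : realFieldType) (S : structure R) (T : dtype R).
Hypothesis DC : definably_complete S.
Variables (A : T -> Prop) (a0 : T) (phi : T -> R) (d : T -> T -> R).
Hypotheses (dA : Def S A) (dphi : defun S phi)
  (dd : defun S (fun p : T * T => d p.1 p.2)).
Hypotheses (Aa0 : A a0) (phi_ge0 : forall x, 0 <= phi x).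
Hypotheses (d_ge0 : forall x y, 0 <= d x y) (d_le1 : forall x y, d x y <= 1)
  (d_sym : forall x y, d x y = d y x)
  (d_tri : forall y x z, d x z <= d x y + d y z).

Definition set_dist x := infR (fun r => exists a, A a /\ r = d x a).

Definition hausdorff_ext x :=
  if `[< A x >] then phi x
  else infR (fun r => exists a, A a /\ r = phi a + d x a / set_dist x - 1).

Lemma defun_set_dist : defun S set_dist.
Proof. by apply: defun_inf; def. Qed.

Lemma defun_hausdorff_ext : defun S hausdorff_ext.
Proof.
have dr := defun_set_dist; rewrite /hausdorff_ext.
by apply: defun_if => //; apply: defun_inf; def.
Qed.

Lemma Def_dists x : Def S (fun r : R => exists a, A a /\ r = d x a).
Proof. by def. Qed.

Lemma set_dist_le x a : A a -> set_dist x <= d x a.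
Proof.
move=> Aa; apply: (infR_le (b := 0) DC (Def_dists x)); last by exists a.
by move=> r [b [_ ->]].
Qed.

Lemma set_dist_ge x b : (forall a, A a -> b <= d x a) -> b <= set_dist x.
Proof.
move=> H; apply: (infR_ge DC (Def_dists x)); first by exists (d x a0), a0.
by move=> r [a [Aa ->]]; apply: H.
Qed.

Lemma set_dist_ge0 x : 0 <= set_dist x.
Proof. exact: set_dist_ge. Qed.

(** Triangle inequality, after taking the infimum over [A]. *)
Lemma set_dist_lip x y : set_dist x <= set_dist y + d x y.
Proof.
rewrite -lerBlDr; apply: set_dist_ge => a Aa.
rewrite lerBlDr addrC; exact: le_trans (set_dist_le x Aa) (d_tri _ _ _).
Qed.

Lemma Def_values x :
  Def S (fun r : R => exists a, A a /\ r = phi a + d x a / set_dist x - 1).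
Proof. by def. Qed.

(** Provides the lower bound that makes the infimum in [hausdorff_ext] exist. It also covers
    [set_dist x = 0], where the quotient is 0 by convention. *)
Lemma values_ge x r :
  (exists a, A a /\ r = phi a + d x a / set_dist x - 1) -> -1 <= r.
Proof.
case=> a [Aa ->]; rewrite -subr_ge0 opprK subrK.
by rewrite addr_ge0 // divr_ge0 ?set_dist_ge0.
Qed.

Lemma hausdorff_extE x : A x -> hausdorff_ext x = phi x.
Proof. by rewrite /hausdorff_ext; case: asboolP. Qed.

Lemma hausdorff_ext_le x a : ~ A x -> A a ->
  hausdorff_ext x <= phi a + d x a / set_dist x - 1.
Proof.
rewrite /hausdorff_ext; case: asboolP => // _ _ Aa.
by apply: (infR_le DC (Def_values x) (@values_ge x)); exists a.
Qed.

Lemma hausdorff_ext_ge x b : ~ A x ->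
  (forall a, A a -> b <= phi a + d x a / set_dist x - 1) -> b <= hausdorff_ext x.
Proof.
rewrite /hausdorff_ext; case: asboolP => // _ _ H.
apply: (infR_ge DC (Def_values x)) => [|r [a [Aa ->]]]; last exact: H.
by exists (phi a0 + d x a0 / set_dist x - 1), a0.
Qed.

(** Stability of a quotient under errors [eta] in numerator and denominator. Since [r] and [u] are
    at most 1, [v * r <= u * r + eta <= u * s + eta + eta]; then divide by [r * s]. *)
Lemma ler_ratio (u v r s eta eps : R) : 0 <= u -> u <= 1 -> 0 < r -> r <= 1 ->
  0 < s -> 0 <= eta -> v <= u + eta -> r <= s + eta -> eta + eta <= eps * (r * s) ->
  v / s <= u / r + eps.
Proof.
move=> u0 u1 r0 r1 s0 e0 vu rs e2.
have -> : u / r + eps = (u * s + eps * (r * s)) / (r * s).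
  rewrite mulrDl mulfK ?mulf_neq0 ?gt_eqF //; congr (_ + _).
  by rewrite invfM mulrACA divff ?gt_eqF // mulr1.
have -> : v / s = (v * r) / (r * s).
  by rewrite [r * s]mulrC invfM mulrACA divff ?gt_eqF // mulr1.
rewrite ler_pM2r ?invr_gt0 ?mulr_gt0 //.
have h1 : 0 <= (u + eta - v) * r by apply: mulr_ge0; lra.
have h2 : 0 <= u * (s + eta - r) by apply: mulr_ge0; lra.
have h3 : 0 <= eta * (1 - u) by apply: mulr_ge0; lra.
have h4 : 0 <= eta * (1 - r) by apply: mulr_ge0; lra.
nra.
Qed.

Lemma hausdorff_ext_cvg_out x eps : ~ A x -> 0 < set_dist x -> 0 < eps ->
  exists delta, 0 < delta /\
    forall y, d x y < delta -> `|hausdorff_ext y - hausdorff_ext x| < eps.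
Proof.
move=> nAx; set r := set_dist x => r0 e0.
have r1 : r <= 1 by apply: le_trans (set_dist_le x Aa0) _.
(* The bound [r / 2] keeps [y] off [A] and gives [s >= r / 2]; the other one then gives
   [eta + eta <= eps / 2 * (r * s)], as [ler_ratio] requires. *)
pose eta := Num.min (r / 2) (eps * (r * r) / 8).
have rr0 : 0 < eps * (r * r) by rewrite !mulr_gt0.
have eta0 : 0 < eta by rewrite lt_min; apply/andP; split; lra.
have eta1 : eta <= r / 2 by rewrite ge_min lexx.
have eta2 : eta <= eps * (r * r) / 8 by rewrite ge_min lexx orbT.
exists eta; split=> // y xy.
have nAy : ~ A y by move=> /(set_dist_le x); rewrite -/r; lra.
have xys := d_sym x y.
have := set_dist_lip y x; have := set_dist_lip x y; rewrite -/r.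
set s := set_dist y => rs sr.
have s1 : s <= 1 by apply: le_trans (set_dist_le y Aa0) _.
have s2 : r / 2 <= s by lra.
have e2 : eta + eta <= eps / 2 * (r * s).
  have : 0 <= eps * r * (s - r / 2) by rewrite !mulr_ge0 ?subr_ge0 ?(ltW e0) ?(ltW r0).
  by nra.
(* The estimate is uniform in [a], so it passes to the infima. *)
have near a : d y a / s <= d x a / r + eps / 2 /\ d x a / r <= d y a / s + eps / 2.
  have := d_tri y x a; have := d_tri x y a => t1 t2.
  by split; apply: (@ler_ratio _ _ _ _ eta) => //; try lra; rewrite [s * r]mulrC.
have : hausdorff_ext x - eps / 2 <= hausdorff_ext y.
  apply: hausdorff_ext_ge => // a Aa; have := hausdorff_ext_le nAx Aa.
  by have := near a; rewrite -/r -/s => -[]; lra.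
have : hausdorff_ext y - eps / 2 <= hausdorff_ext x.
  apply: hausdorff_ext_ge => // a Aa; have := hausdorff_ext_le nAy Aa.
  by have := near a; rewrite -/r -/s => -[]; lra.
by rewrite ltr_norml => *; apply/andP; split; lra.
Qed.

(** For [y] off [A], the upper bound comes from a nearly closest point [a], whose quotient is barely
    above 1. For the lower bound, points [a] near [x] have quotient at least 1 and [phi a] close to
    [phi x], while for points far from [x] the quotient alone exceeds [phi x], and [phi a >= 0]. *)
Lemma hausdorff_ext_cvg_in x eps (X : T -> Prop) : A x -> 0 < eps ->
  (forall y, X y -> ~ A y -> 0 < set_dist y) ->
  (forall e, 0 < e -> exists delta, 0 < delta /\
    forall y, A y -> d x y < delta -> `|phi y - phi x| < e) ->
  exists delta, 0 < delta /\
    forall y, X y -> d x y < delta -> `|hausdorff_ext y - hausdorff_ext x| < eps.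
Proof.
move=> Ax e0 Xr cphi; rewrite (hausdorff_extE Ax).
have e20 : 0 < eps / 2 by lra.
have [d0 [d00 phid]] := cphi _ e20.
have px := phi_ge0 x.
(* With [delta = d0 / k] two bounds hold: [(2 + eps / 2) * delta <= d0], for the nearly closest
   point, and [(phi x + 1) * delta <= d0 - delta], for the far points. *)
pose k := phi x + eps + 4; have k0 : 0 < k by rewrite /k; lra.
have delta0 : 0 < d0 / k by rewrite divr_gt0.
have dk : d0 / k * k = d0 by rewrite divfK ?gt_eqF.
move: delta0 dk; set delta := d0 / k => delta0 dk.
have px0 : 0 <= delta * phi x by rewrite mulr_ge0 // ltW.
have pe0 : 0 < delta * eps by rewrite mulr_gt0.
rewrite /k !mulrDr in dk.
exists delta; split=> // y Xy xy.
case: (pselect (A y)) => [Ay|nAy].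
  rewrite hausdorff_extE //; apply: lt_le_trans (phid y Ay _) _; lra.
have := Xr y Xy nAy; have := set_dist_le y Ax; set s := set_dist y => sxy s0.
have syx := d_sym x y.
have up : hausdorff_ext y < phi x + eps.
  (* As [s > 0], the number [(1 + eps / 2) * s] exceeds the infimum [s] of the distances. *)
  have [a Aa ya] : exists2 a, A a & d y a < (1 + eps / 2) * s.
    apply: contrapT => H; have : (1 + eps / 2) * s <= s; last nra.
    apply: set_dist_ge => a Aa; rewrite leNgt; apply/negP => ya.
    by apply: H; exists a.
  have xa : d x a < d0.
    apply: le_lt_trans (d_tri y _ _) _.
    have : 0 <= (1 + eps / 2) * (delta - s) by apply: mulr_ge0; lra.
    nra.
  have := phid a Aa xa; rewrite ltr_norml => /andP[_ pa].
  have := hausdorff_ext_le nAy Aa; rewrite -/s.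
  have : d y a / s < 1 + eps / 2 by rewrite ltr_pdivrMr.
  lra.
have lo : phi x - eps / 2 <= hausdorff_ext y.
  apply: hausdorff_ext_ge => // a Aa; rewrite -/s.
  have pa := phi_ge0 a.
  case: (ltP (d x a) d0) => [xa|xa].
    have := phid a Aa xa; rewrite ltr_norml => /andP[ap _].
    have : 1 <= d y a / s by rewrite ler_pdivlMr // mul1r set_dist_le.
    lra.
  (* Far case: [d y a >= d0 - delta], whereas [s < delta]. *)
  have : phi x + 1 <= d y a / s; last lra.
  rewrite ler_pdivlMr //.
  have := d_tri y x a.
  have : 0 <= (phi x + 1) * (delta - s) by apply: mulr_ge0; lra.
  nra.
by rewrite ltr_norml; apply/andP; split; lra.
Qed.

(** The map [f] sends [A] into [A], and onto it because [g] is a right inverse there. Hence the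
    infima at [f x] and at [x] range over the same values. *)
Lemma hausdorff_ext_isom (f g : T -> T) x : (A (f x) <-> A x) ->
  (forall a, A a -> A (f a) /\ phi (f a) = phi a) ->
  (forall a, A a -> A (g a) /\ f (g a) = a) ->
  (forall a, A a -> d (f x) (f a) = d x a) ->
  hausdorff_ext (f x) = hausdorff_ext x.
Proof.
move=> Afx Af Ag df.
have sf : set_dist (f x) = set_dist x.
  apply/le_anti/andP; split; apply: set_dist_ge => a Aa.
    by rewrite -df //; apply: set_dist_le; apply: (Af _ Aa).1.
  have [Aga <-] := Ag a Aa; rewrite df //; exact: set_dist_le.
case: (pselect (A x)) => [Ax|nAx].
  by rewrite !hausdorff_extE ?(Af _ Ax).2 //; apply/Afx.
have nAfx : ~ A (f x) by move=> /Afx.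
apply/le_anti/andP; split; apply: hausdorff_ext_ge => // a Aa.
  by have [Afa <-] := Af a Aa; rewrite -(df a) // -sf; apply: hausdorff_ext_le.
have [Aga fga] := Ag a Aa.
by rewrite -fga (Af _ Aga).2 df // sf; apply: hausdorff_ext_le.
Qed.

End HausdorffExtension.

(** * Graphs of functions on a definable subset *)

Section DefinableFun.
Variables (R : realFieldType) (S : structure R) (n : nat).
Implicit Type A : set 'rV[R]_n.

Lemma definable_funE k A (f : 'rV[R]_n -> 'rV[R]_k) : definable_fun S A f <->
  Def S (fun p : 'rV[R]_n * 'rV[R]_k => A p.1 /\ p.2 = f p.1).
Proof.
have E (z : 'rV[R]_(n + k)) : (exists x, A x /\ z = row_mx x (f x)) <->
    A (lsubmx z) /\ rsubmx z = f (lsubmx z).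
  split=> [[x [Ax ->]]|[Az fz]]; first by rewrite row_mxKl row_mxKr.
  by exists (lsubmx z); split=> //; rewrite -fz hsubmxK.
by split; apply: eq_dfn => z; split=> /E.
Qed.

Lemma definable_scalE A (f : 'rV[R]_n -> R) : definable_fun S A (scal f) <->
  Def S (fun p : 'rV[R]_n * R => A p.1 /\ p.2 = f p.1).
Proof.
rewrite definable_funE; split; apply: eq_dfn => z /=; rewrite /scal.
  by split=> -[Az H]; split=> //; [rewrite H mxE|rewrite -H const_mx1K].
by split=> -[Az H]; split=> //; [rewrite -H const_mx1K|rewrite H mxE].
Qed.

End DefinableFun.

(** * The invariant distance *)

Section InvariantDistance.
Variables (R : realFieldType) (S : structure R) (m n : nat).
Variables (G : set 'rV[R]_m) (mul : 'rV[R]_m -> 'rV[R]_m -> 'rV[R]_m)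
  (inv : 'rV[R]_m -> 'rV[R]_m) (e : 'rV[R]_m).
Variables (X : set 'rV[R]_n) (act : 'rV[R]_m -> 'rV[R]_n -> 'rV[R]_n).
Hypotheses (DC : definably_complete S) (Ggrp : definable_top_group S G mul inv e)
  (Gcpt : definably_compact S G) (Xact : definable_G_set S G mul e X act).

Implicit Types (x y z : 'rV[R]_n) (g h : 'rV[R]_m) (r b d eps : R).

(** The value 0 off [G] times [X] makes the action a total definable function. *)
Definition total_act g x := if `[< G g /\ X x >] then act g x else 0.

(* The supremum over [g] of the sup-norm distance of [gx] and [gy], truncated at 1,
   written as an infimum of upper bounds. *)
Definition inv_dist x y := infR (fun r => 0 <= r /\
  (1 <= r \/ forall g, G g -> forall i, `|total_act g x 0 i - total_act g y 0 i| <= r)).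

Lemma total_actE g x : G g -> X x -> total_act g x = act g x.
Proof. by move=> Gg Xx; rewrite /total_act; case: asboolP => // -[]. Qed.

Lemma DefG : Def S (G : 'rV[R]_m -> Prop).
Proof. by case: Gcpt. Qed.

Lemma DefX : Def S (X : 'rV[R]_n -> Prop).
Proof. by case: Xact => -[]. Qed.

Lemma defun_total_act :
  defun S (fun p : 'rV[R]_m * 'rV[R]_n => total_act p.1 p.2).
Proof.
case: Xact => _ _ _ /definable_funE da _.
have da' : Def S (fun p : 'rV[R]_m * 'rV[R]_n * 'rV[R]_n =>
    (G p.1.1 /\ X p.1.2) /\ p.2 = act p.1.1 p.1.2) by exact: da.
exact: (defun_total (P := fun p : 'rV[R]_m * 'rV[R]_n => G p.1 /\ X p.2)
  (f := fun p => act p.1 p.2) da').2.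
Qed.

Lemma Def_bounds x y : Def S (fun r => 0 <= r /\
  (1 <= r \/ forall g, G g -> forall i, `|total_act g x 0 i - total_act g y 0 i| <= r)).
Proof. by have da := defun_total_act; have dG := DefG; def. Qed.

Lemma defun_inv_dist : defun S (fun p : 'rV[R]_n * 'rV[R]_n => inv_dist p.1 p.2).
Proof.
have da := defun_total_act; have dG := DefG.
by apply: defun_inf; def.
Qed.

Lemma inv_dist_le x y r : 0 <= r ->
  (1 <= r \/ forall g, G g -> forall i, `|total_act g x 0 i - total_act g y 0 i| <= r) ->
  inv_dist x y <= r.
Proof. by move=> r0 H; apply: (infR_le (b := 0) DC (Def_bounds x y)) => // s []. Qed.

Lemma inv_dist_le1 x y : inv_dist x y <= 1.
Proof. by apply: inv_dist_le => //; left. Qed.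

Lemma inv_dist_ge x y b : (forall r, 0 <= r ->
  (1 <= r \/ forall g, G g -> forall i, `|total_act g x 0 i - total_act g y 0 i| <= r) ->
  b <= r) -> b <= inv_dist x y.
Proof.
move=> H; apply: (infR_ge DC (Def_bounds x y)) => [|r []]; last exact: H.
by exists 1; split=> //; left.
Qed.

Lemma inv_dist_ge0 x y : 0 <= inv_dist x y.
Proof. exact: inv_dist_ge. Qed.

(** Below 1 the truncation is inactive: every admissible bound is at least [min 1 u], with [u] the
    coordinate difference. *)
Lemma inv_dist_coord x y g i : G g -> inv_dist x y < 1 ->
  `|total_act g x 0 i - total_act g y 0 i| <= inv_dist x y.
Proof.
move=> Gg d1; set u := `|_|.
have : Num.min 1 u <= inv_dist x y.
  by apply: inv_dist_ge => r _ [r1|/(_ g Gg i) H]; rewrite ge_min ?r1 ?H ?orbT.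
by rewrite ge_min leNgt d1.
Qed.

Lemma inv_dist_sym x y : inv_dist x y = inv_dist y x.
Proof.
suff H u v : inv_dist u v <= inv_dist v u by apply/le_anti; rewrite !H.
apply: inv_dist_ge => r r0 H; apply: inv_dist_le => //.
by case: H => H; [left|right=> g Gg i; rewrite distrC; apply: H].
Qed.

Lemma inv_dist_tri y x z : inv_dist x z <= inv_dist x y + inv_dist y z.
Proof.
have := inv_dist_ge0 x y; have := inv_dist_ge0 y z; have := inv_dist_le1 x z.
case: (ltP (inv_dist x y) 1) => [xy|]; last by lra.
case: (ltP (inv_dist y z) 1) => [yz|]; last by lra.
move=> _ yz0 xy0; apply: inv_dist_le; first exact: addr_ge0.
right=> g Gg i; apply: le_trans (ler_distD (total_act g y 0 i) _ _) _.
by rewrite lerD ?inv_dist_coord.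
Qed.

Lemma act_stable g x : G g -> X x -> X (act g x).
Proof. by case: Xact => -[_ H] *; apply: H. Qed.

Lemma act_invK g x : G g -> X x -> act (inv g) (act g x) = x.
Proof.
case: Ggrp => -[_ _] [_ Ginv] [_ [_ Gi]] _ _; case: Xact => _ acte actM _ _ Gg Xx.
by rewrite -actM ?(Gi g Gg).1 ?acte //; apply: Ginv.
Qed.

Lemma inv_stable g : G g -> G (inv g).
Proof. by case: Ggrp => _ [_ H] *; apply: H. Qed.

Lemma act_Kinv g x : G g -> X x -> act g (act (inv g) x) = x.
Proof.
case: Ggrp => -[_ _] [_ Ginv] [_ [_ Gi]] _ _; case: Xact => _ acte actM _ _ Gg Xx.
by rewrite -actM ?(Gi g Gg).2 ?acte //; apply: Ginv.
Qed.

(** Moving both points by [g] replaces the translates by [k] with those by [kg], so the distance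
    cannot grow. Applying this to the inverse of [h] gives equality. *)
Lemma inv_dist_act h x y : G h -> X x -> X y ->
  inv_dist (act h x) (act h y) = inv_dist x y.
Proof.
suff H g u v : G g -> X u -> X v -> inv_dist (act g u) (act g v) <= inv_dist u v.
  move=> Gh Xx Xy; apply/le_anti; rewrite H //=.
  rewrite -{1}[x](act_invK Gh Xx) -{1}[y](act_invK Gh Xy).
  by apply: H; [apply: inv_stable|apply: act_stable|apply: act_stable].
move=> Gg Xu Xv; case: (ltP (inv_dist u v) 1) => [uv|]; last first.
  exact: le_trans (inv_dist_le1 _ _).
apply: inv_dist_le; first exact: inv_dist_ge0.
right=> k Gk i; case: Ggrp => _ [Gmul _] _ _ _; case: Xact => _ _ actM _ _.
rewrite !total_actE -?actM //; try exact: act_stable.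
by have := inv_dist_coord i (Gmul _ _ Gk Gg) uv; rewrite !total_actE //; apply: Gmul.
Qed.

(** Take the identity of [G] among the translates. Together with [inv_dist_cvg] this shows that
    [inv_dist] induces the topology of [X]. *)
Lemma box_inv_dist x y d : X x -> X y -> 0 < d -> inv_dist x y < Num.min 1 d ->
  box x d y.
Proof.
move=> Xx Xy d0; rewrite lt_min => /andP[xy1 xyd] i.
case: Ggrp => -[_ Ge] _ _ _ _; case: Xact => _ acte _ _ _.
have := inv_dist_coord i Ge xy1; rewrite !total_actE // !acte // distrC => H.
exact: le_lt_trans H xyd.
Qed.

Lemma act_equicontinuous x eps : X x -> 0 < eps -> exists d, 0 < d /\
  forall g y, G g -> X y -> box x d y -> box (act g x) eps (act g y).
Proof.
move=> Xx e0; apply: contrapT => noD.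
(* The group elements violating the claim at radius [d], written with [total_act] so that the family
   is visibly definable. *)
pose D (d : R) (g : 'rV[R]_m) := G g /\ exists y : 'rV[R]_n,
  (X y /\ (forall i, `|y 0 i - x 0 i| < d)) /\
  ~ (forall i, `|total_act g y 0 i - total_act g x 0 i| < eps).
have da := defun_total_act; have dG := DefG; have dX := DefX.
have Ddec : decreasing_family S D.
  split.
  - by rewrite /D; def.
  - move=> d d' g dd' [Gg [y [[Xy xy] nxy]]]; split=> //; exists y; split=> //.
    by split=> // i; apply: lt_le_trans dd'.
  - move=> d d0; apply: contrapT => nD; apply: noD; exists d; split=> // g y Gg Xy xy.
    apply: contrapT => nxy; apply: nD; exists g; split=> //; exists y; split=> //.
    by rewrite !total_actE.
have [_ [Gcl [M GM]]] := Gcpt.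
have [|s sD] := cluster_point DC (M := M) Ddec; first by move=> d g [/GM].
have Gs : G s.
  apply: contrapT => /Gcl [d [d0 dG']]; have [g [Gg _] gs] := sD d d0.
  exact: dG' gs Gg.
case: Xact => _ _ _ _ actC.
have sxp : pairs G X (row_mx s x) by split; rewrite ?row_mxKl ?row_mxKr.
have e20 : 0 < eps / 2 by lra.
have [d [d0 dC]] := actC _ sxp _ e20.
have [g [Gg [y [[Xy xy] nxy]]] gs] := sD d d0.
(* Continuity at [(s, x)] puts both [gx] and [gy] within [eps / 2] of [sx], contradicting the choice
   of [g] and [y]. *)
have near z : X z -> (forall i, `|z 0 i - x 0 i| < d) ->
    box (act s x) (eps / 2) (act g z).
  move=> Xz xz; have := dC (row_mx g z); rewrite !row_mxKl !row_mxKr; apply.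
    by split; rewrite ?row_mxKl ?row_mxKr.
  by move=> i; rewrite !mxE; case: split => j; [apply: gs|apply: xz].
apply: nxy => i; rewrite !total_actE //.
have := near x Xx; have := near y Xy xy i.
rewrite distrC => yi /(_ _ i) xi.
have : `|act g x 0 i - act s x 0 i| < eps / 2 by apply: xi => j; rewrite subrr normr0.
move: yi; rewrite !ltr_norml => /andP[? ?] /andP[? ?]; apply/andP; split; lra.
Qed.

Lemma inv_dist_cvg x eps : X x -> 0 < eps -> exists d, 0 < d /\
  forall y, X y -> box x d y -> inv_dist x y <= eps.
Proof.
move=> Xx e0; have [d [d0 H]] := act_equicontinuous Xx e0.
exists d; split=> // y Xy xy; apply: inv_dist_le; first exact: ltW.
right=> g Gg i; rewrite !total_actE // distrC; apply: ltW; exact: H.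
Qed.

(** * Invariant extension of nonnegative functions *)

Variables (A : set 'rV[R]_n).
Hypotheses (AX : A `<=` X) (dA : S n A) (GA : G_invariant_set G act A)
  (Acl : closed_in X A).

Lemma G_tietze_ge0 (psi : 'rV[R]_n -> R) : (exists a, A a) ->
  defun S psi -> (forall x, 0 <= psi x) -> continuous_on A (scal psi) ->
  G_invariant_fun G act A psi ->
  exists Psi : 'rV[R]_n -> R,
    [/\ defun S Psi, continuous_on X (scal Psi), G_invariant_fun G act X Psi
      & forall x, A x -> Psi x = psi x].
Proof.
case=> a0 Aa0 dpsi psi0 cpsi Gpsi.
have dA' : Def S (A : 'rV[R]_n -> Prop) by [].
have dd := defun_inv_dist.
exists (hausdorff_ext A psi inv_dist); split.
- exact: defun_hausdorff_ext.
- move=> x Xx eps e0.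
  have [d [d0 dX]] : exists d, 0 < d /\ forall y, X y -> inv_dist x y < d ->
      `|hausdorff_ext A psi inv_dist y - hausdorff_ext A psi inv_dist x| < eps.
    (* A box of radius [r] around [y] misses [A], since [A] is closed in [X]; so all points of [A]
       have invariant distance at least [min 1 r] from [y]. *)
    have pos y : X y -> ~ A y -> 0 < set_dist A inv_dist y.
      move=> Xy nAy; case: Acl => C [Ccl AC].
      have nCy : (~` C) y by move=> Cy; apply: nAy; rewrite AC.
      have [r [r0 rC]] := Ccl _ nCy.
      apply: (@lt_le_trans _ _ (Num.min 1 r)); first by rewrite lt_min ltr01.
      apply: (set_dist_ge DC dA' dd Aa0) => a Aa.
      rewrite leNgt; apply/negP => /(box_inv_dist Xy (AX Aa) r0) /rC; apply.
      by move: Aa; rewrite AC => -[].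
    case: (pselect (A x)) => [Ax|nAx]; last first.
      have [d [d0 H]] := hausdorff_ext_cvg_out DC dA' dpsi dd Aa0 psi0 inv_dist_ge0
        inv_dist_le1 inv_dist_sym inv_dist_tri nAx (pos x Xx nAx) e0.
      by exists d; split=> // y _; apply: H.
    apply: (hausdorff_ext_cvg_in DC dA' dpsi dd Aa0 psi0 inv_dist_ge0
      inv_dist_sym inv_dist_tri Ax e0 pos) => r r0.
    have [d [d0 H]] := cpsi x Ax r r0; exists (Num.min 1 d).
    split=> [|y Ay /(box_inv_dist (AX Ax) (AX Ay) d0) /(H y Ay) /(_ 0)].
      by rewrite lt_min ltr01.
    by rewrite !mxE.
  (* Back from the invariant distance to boxes; halving [d] turns the weak inequality of
     [inv_dist_cvg] into a strict one. *)
  have d20 : 0 < d / 2 by lra.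
  have [r [r0 H]] := inv_dist_cvg Xx d20; exists r; split=> // y Xy xy i.
  by rewrite !mxE; apply: dX => //; have := H y Xy xy; lra.
- move=> h x Gh Xx; have Gh' := inv_stable Gh.
  apply: (hausdorff_ext_isom DC dA' dpsi dd Aa0 psi0 inv_dist_ge0 (f := act h)
    (g := act (inv h))) => [|a Aa|a Aa|a Aa].
  + by split=> [/(GA Gh')|/(GA Gh) //]; rewrite act_invK.
  + by split; [apply: GA|apply: Gpsi].
  + by split; [apply: GA|apply: act_Kinv => //; apply: AX].
  + by apply: inv_dist_act => //; apply: AX.
- by move=> x; apply: hausdorff_extE.
Qed.

End InvariantDistance.

(** * Extension of functions of arbitrary sign *)

Theorem theorem2p2 (R : realFieldType) (S : structure R) (m n : nat)
  (G : set 'rV[R]_m) (mul : 'rV[R]_m -> 'rV[R]_m -> 'rV[R]_m)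
  (inv : 'rV[R]_m -> 'rV[R]_m) (e : 'rV[R]_m)
  (X : set 'rV[R]_n) (act : 'rV[R]_m -> 'rV[R]_n -> 'rV[R]_n)
  (A : set 'rV[R]_n) (phi : 'rV[R]_n -> R) :
  definably_complete S ->
  definable_top_group S G mul inv e ->
  definably_compact S G ->
  definable_G_set S G mul e X act ->
  locally_closed X ->
  A `<=` X -> S n A -> G_invariant_set G act A -> closed_in X A ->
  definable_fun S A (scal phi) -> continuous_on A (scal phi) ->
  G_invariant_fun G act A phi ->
  exists Phi : 'rV[R]_n -> R,
    [/\ definable_fun S X (scal Phi), continuous_on X (scal Phi),
        G_invariant_fun G act X Phi
      & forall x, A x -> Phi x = phi x].
Proof.
move=> DC Ggrp Gcpt Xact _ AX dA GA Acl /definable_scalE dphi cphi Gphi.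
have dX := DefX Xact.
suff [Phi [dPhi cPhi GPhi PhiA]] : exists Phi : 'rV[R]_n -> R,
    [/\ defun S Phi, continuous_on X (scal Phi), G_invariant_fun G act X Phi
      & forall x, A x -> Phi x = phi x].
  exists Phi; split=> //; apply/definable_scalE.
  by apply: (DefI (P := fun p : 'rV[R]_n * R => X p.1)) dPhi; def.
(* Hausdorff's formula needs a point of [A]; for empty [A] the zero function serves. *)
case: (pselect (exists a, A a)) => [neA|eA]; last first.
  exists (fun=> 0); split=> // [|x Xx eps e0|x Ax]; first exact: defun_const.
    by exists 1; split=> // y _ _ i; rewrite !mxE subrr normr0.
  by case: eA; exists x.
(* The extension by 0 makes [f] total and definable; continuity is claimed only along [A]. *)
pose f x := if `[< A x >] then phi x else 0.
have df : defun S f by exact: (defun_total (P := A : _ -> Prop) dphi).2.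
have fE x : A x -> f x = phi x by rewrite /f; case: asboolP.
have Gf h x : G h -> A x -> f (act h x) = f x.
  by move=> Gh Ax; rewrite !fE ?Gphi //; apply: GA.
have cf x eps : A x -> 0 < eps -> exists d, 0 < d /\
    forall y, A y -> box x d y -> `|f y - f x| < eps.
  move=> Ax e0; have [d [d0 H]] := cphi x Ax eps e0; exists d; split=> // y Ay.
  by move=> /(H y Ay) /(_ 0); rewrite !mxE !fE.
have near (u v : R) : `| `|u| - `|v| | <= `|u - v| by exact: ler_dist_dist.
have [||||P [dP cP GP PA]] := G_tietze_ge0 DC Ggrp Gcpt Xact AX dA GA Acl
  (psi := fun x => `|f x|) neA.
- by def.
- by move=> x; apply: normr_ge0.
- move=> x Ax eps e0; have [d [d0 H]] := cf x eps Ax e0; exists d; split=> // y Ay xy i.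
  by rewrite !mxE; apply: le_lt_trans (near _ _) _; apply: H.
- by move=> h x Gh Ax; rewrite Gf.
have [||||Q [dQ cQ GQ QA]] := G_tietze_ge0 DC Ggrp Gcpt Xact AX dA GA Acl
  (psi := fun x => `|f x| - f x) neA.
- by def.
- by move=> x; rewrite subr_ge0 ler_norm.
- move=> x Ax eps e0; have e20 : 0 < eps / 2 by lra.
  have [d [d0 H]] := cf x _ Ax e20; exists d; split=> // y Ay xy i.
  have := near (f y) (f x); have := H y Ay xy; rewrite !mxE.
  move=> fxy /le_lt_trans /(_ fxy).
  move: fxy; rewrite !ltr_norml => /andP[? ?] /andP[? ?]; apply/andP; split; lra.
- by move=> h x Gh Ax; rewrite Gf.
(* On [A] this is [|f| - (|f| - f) = f]. *)
exists (fun x => P x - Q x); split.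
- by def.
- move=> x Xx eps e0; have e20 : 0 < eps / 2 by lra.
  have [d [d0 H]] := cP x Xx _ e20; have [d' [d0' H']] := cQ x Xx _ e20.
  exists (Num.min d d'); split; first by rewrite lt_min d0.
  move=> y Xy xy i; have xyd : box x d y by move=> j; have := xy j; rewrite lt_min => /andP[].
  have xyd' : box x d' y by move=> j; have := xy j; rewrite lt_min => /andP[].
  have := H y Xy xyd i; have := H' y Xy xyd' i; rewrite !mxE.
  rewrite !ltr_norml => /andP[? ?] /andP[? ?]; apply/andP; split; lra.
- by move=> h x Gh Xx; rewrite GP ?GQ.
- by move=> x Ax; rewrite PA // QA // fE //; lra.
Qed.
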